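(* In the Truthful Interval Covering setting with $n$ agents (with $n$ a positive multiple of $6$) and unit-length intervals, the Uniform-Statistic mechanism has approximation ratio at most $5/3$: for every instance $\mathcal{I}$, $\mathbb{E}[\mathrm{SC}(\mathcal{M}(\mathcal{I}))]\le \frac{5}{3}\min_C\mathrm{SC}(C)$.
   Context: There are $n$ agents; agent $i$ has an interval $I_i=[s_i,s_i+1]$ of length $1$; an instance is $\mathcal{I}=(I_1,\dots,I_n)$, with agents indexed so that $s_1\le s_2\le\dots\le s_n$. A unit covering interval $C$ is placed; $\mathrm{cost}_i(C)=1-|I_i\cap C|$ ($|\cdot|$ = length), $\mathrm{SC}(C)=\sum_i\mathrm{cost}_i(C)$, minimum over all unit intervals $C$. The Uniform-Statistic mechanism lets $\ell$ be the $(n/3)$-th agent, $m$ the median agent (the $(n/2)$-th agent) and $r$ the $(2n/3)$-th agent in this order, and places $C$ at $I_\ell$, $I_m$ or $I_r$, each with probability $1/3$. The expectation is over this randomization. *)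

(* Defs.v *)
From mathcomp Require Import all_boot all_order all_algebra.
Set Implicit Arguments. Unset Strict Implicit. Unset Printing Implicit Defensive.
Import Order.TTheory GRing.Theory Num.Theory.
Local Open Scope ring_scope.

Section IntervalCovering.
Variable R : realFieldType.

Definition inter_len (a b : R) : R :=
  Num.max 0 (Num.min (a + 1) (b + 1) - Num.max a b).

Definition cost (s c : R) : R := 1 - inter_len s c.

(* agents are 1-indexed: s 1, ..., s n are the left endpoints *)
Definition SC (n : nat) (s : nat -> R) (c : R) : R :=
  \sum_(1 <= i < n.+1) cost (s i) c.

(* expected social cost of the Uniform-Statistic mechanism:
   C placed at I_(n/3), I_(n/2), I_(2n/3), each with probability 1/3 *)
Definition US_expected_SC (n : nat) (s : nat -> R) : R :=
  (SC n s (s (n %/ 3)%N) + SC n s (s (n %/ 2)%N) + SC n s (s ((2 * n) %/ 3)%N)) / 3.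

End IntervalCovering.

(* Main.v *)
Require Import Defs.
From mathcomp Require Import all_boot all_order all_algebra.
From mathcomp Require Import zify ring lra.
Import Order.TTheory GRing.Theory Num.Theory.
Local Open Scope ring_scope.

(** The cost [d x y = min 1 |x - y|] is a metric on the line that is monotone
    in the following sense: if [x <= y <= z] then both [d x y] and [d y z] are
    at most [d x z].  Write [n = 6k], fix [c], and let [f x] be the excess
    [5 d(x,c) - d(x,l) - d(x,m) - d(x,r)].  The points [l <= m <= r] cut the line
    into four pieces, holding [2k], [k], [k], [2k] agents respectively (ties at
    the cut points being split by index).  The triangle inequality and
    monotonicity bound [f] from below on the pieces by combinations
    [g1, g2, g3, g4] of [d(c,l)], [d(c,m)] and [d(c,r)], chosen so that [2 g1 + g2 + g3 + 2 g4 >= 0].  Hence the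
    excesses of all the agents have a nonnegative sum. *)

Section CappedDistance.
Variable R : realFieldType.
Implicit Types x y z l m r c : R.

Lemma costE x y : cost x y = Num.min 1 `|x - y|.
Proof.
rewrite /cost /inter_len -addr_minl.
have [xy|yx] := leP x y.
  by rewrite ler0_norm; [do 2 case: lerP => ?; lra|lra].
by rewrite gtr0_norm; [do 2 case: lerP => ?; lra|lra].
Qed.

Lemma costC x y : cost x y = cost y x.
Proof. by rewrite !costE distrC. Qed.

Lemma costN x y : cost (- x) (- y) = cost x y.
Proof. by rewrite !costE -opprD normrN. Qed.

Lemma cost_ge0 x y : 0 <= cost x y.
Proof. by rewrite costE le_min ler01 normr_ge0. Qed.

(** Capping at 1 is harmless: a capped term on the right already dominates the left side. *)
Lemma cost_triangle z x y : cost x y <= cost x z + cost z y.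
Proof.
have := ler_distD z x y; have := normr_ge0 (x - z); have := normr_ge0 (z - y).
rewrite !costE; case: (lerP 1 `|x - y|) => ?; case: (lerP 1 `|x - z|) => ?;
  by case: (lerP 1 `|z - y|) => ?; lra.
Qed.

Lemma cost_le_outer x y x' y' :
  x' <= x -> x <= y -> y <= y' -> cost x y <= cost x' y'.
Proof.
move=> xx xy yy; rewrite !costE ![`|_|]ler0_norm; [|lra..].
by case: (lerP 1 (- (x - y))) => ?; case: (lerP 1 (- (x' - y'))) => ?; lra.
Qed.

Definition excess l m r c x : R :=
  5 * cost x c - (cost x l + cost x m + cost x r).

Lemma excessN l m r c x :
  excess (- r) (- m) (- l) (- c) (- x) = excess l m r c x.
Proof. by rewrite /excess !costN; ring. Qed.

(** The closed pieces overlap, so an agent tied with a cut point obeys the bound of whichever piece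
    its index selects. *)
Definition has_balanced_bounds l m r c :=
  exists g1 g2 g3 g4 : R, [/\ 0 <= 2 * g1 + g2 + g3 + 2 * g4,
    forall x, x <= l -> g1 <= excess l m r c x,
    forall x, l <= x <= m -> g2 <= excess l m r c x,
    forall x, m <= x <= r -> g3 <= excess l m r c x &
    forall x, r <= x -> g4 <= excess l m r c x].

(** Reflection reverses the pieces, and the weights 2, 1, 1, 2 are palindromic. *)
Lemma has_balanced_boundsN l m r c :
  has_balanced_bounds (- r) (- m) (- l) (- c) -> has_balanced_bounds l m r c.
Proof.
move=> [g1 [g2 [g3 [g4 [g_ge0 h1 h2 h3 h4]]]]].
exists g4, g3, g2, g1; split => [|x hx|x hx|x hx|x hx]; first lra;
  rewrite -excessN; [apply: h4|apply: h3|apply: h2|apply: h1]; lra.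
Qed.

(** Three triangle inequalities through [c] use only three of the five copies of [cost x c]. This
    serves the pieces where nothing better is needed. *)
Lemma excess_ge l m r c x :
  - (cost c l + cost c m + cost c r) <= excess l m r c x.
Proof.
have := cost_triangle c x l; have := cost_triangle c x m.
have := cost_triangle c x r; have := cost_ge0 x c.
by rewrite /excess; lra.
Qed.

Lemma balanced_bounds_left l m r c :
  l <= m -> m <= r -> c <= l -> has_balanced_bounds l m r c.
Proof.
move=> lm mr cl.
(* For [x] right of [l], each cut point between [c] and [x] cancels one copy of [cost c x], and each
   one beyond [x] costs at most its distance from [c]. The weighted sum is [2 * cost c l]. *)
exists (- (cost c l + cost c m + cost c r)), (4 * cost c l - cost c m - cost c r).
exists (3 * cost c m - cost c r), (2 * cost c r).
split => [|x _|x /andP[lx xm]|x /andP[mx xr]|x rx].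
- by have := cost_ge0 c l; lra.
- exact: excess_ge.
- rewrite /excess [cost x c]costC [cost x l]costC.
  have : cost c l <= cost c x by apply: cost_le_outer; lra.
  have : cost l x <= cost c x by apply: cost_le_outer; lra.
  have : cost x m <= cost c m by apply: cost_le_outer; lra.
  have : cost x r <= cost c r by apply: cost_le_outer; lra.
  by lra.
- rewrite /excess [cost x c]costC [cost x l]costC [cost x m]costC.
  have : cost c m <= cost c x by apply: cost_le_outer; lra.
  have : cost l x <= cost c x by apply: cost_le_outer; lra.
  have : cost m x <= cost c x by apply: cost_le_outer; lra.
  have : cost x r <= cost c r by apply: cost_le_outer; lra.
  by lra.
- rewrite /excess ![cost x _]costC.
  have : cost c r <= cost c x by apply: cost_le_outer; lra.
  have : cost l x <= cost c x by apply: cost_le_outer; lra.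
  have : cost m x <= cost c x by apply: cost_le_outer; lra.
  have : cost r x <= cost c x by apply: cost_le_outer; lra.
  by lra.
Qed.

Lemma balanced_bounds_mid l m r c :
  m <= r -> l <= c -> c <= m -> has_balanced_bounds l m r c.
Proof.
move=> mr lc cm.
(* Cut points across [c] from [x] are reached by the triangle inequality. Here the weighted sum
   vanishes identically, leaving no slack. *)
exists (2 * cost c l - cost c m - cost c r), (- (cost c l + cost c m + cost c r)).
exists (3 * cost c m - cost c l - cost c r), (2 * cost c r - cost c l).
split => [|x xl|x _|x /andP[mx xr]|x rx].
- by lra.
- have := cost_triangle c x m; have := cost_triangle c x r.
  rewrite /excess [cost c l]costC.
  have : cost l c <= cost x c by apply: cost_le_outer; lra.
  have : cost x l <= cost x c by apply: cost_le_outer; lra.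
  by lra.
- exact: excess_ge.
- have := cost_triangle c x l; rewrite /excess [cost x c]costC [cost x m]costC.
  have : cost c m <= cost c x by apply: cost_le_outer; lra.
  have : cost m x <= cost c x by apply: cost_le_outer; lra.
  have : cost x r <= cost c r by apply: cost_le_outer; lra.
  by lra.
- have := cost_triangle c x l.
  rewrite /excess [cost x c]costC [cost x m]costC [cost x r]costC.
  have : cost c r <= cost c x by apply: cost_le_outer; lra.
  have : cost m x <= cost c x by apply: cost_le_outer; lra.
  have : cost r x <= cost c x by apply: cost_le_outer; lra.
  by lra.
Qed.

Lemma balanced_bounds l m r c :
  l <= m -> m <= r -> has_balanced_bounds l m r c.
Proof.
move=> lm mr; have [cm|mc] := leP c m.
  have [cl|lc] := leP c l; first exact: balanced_bounds_left.
  by apply: balanced_bounds_mid; lra.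
(* After reflection, [- c] lies left of [- m], as in the cases above. *)
apply: has_balanced_boundsN; have [cr|rc] := leP c r.
  by apply: balanced_bounds_mid; lra.
by apply: balanced_bounds_left; lra.
Qed.

Lemma sum_nat_ge_const (a k b : nat) (g : R) (F : nat -> R) :
  b = (a + k)%N -> (forall i, (a <= i < b)%N -> g <= F i) ->
  k%:R * g <= \sum_(a <= i < b) F i.
Proof.
move=> -> gF; rewrite mulr_natl -[X in g *+ X](addKn a) -sumr_const_nat.
exact: ler_sum_nat.
Qed.

End CappedDistance.

Theorem theorem5 (R : realFieldType) (n : nat) (s : nat -> R)
  (hn : (0 < n)%N) (h6 : (6 %| n)%N)
  (hsorted : forall i j : nat, (1 <= i)%N -> (i <= j)%N -> (j <= n)%N -> s i <= s j) :
  forall c : R, US_expected_SC n s <= 5 / 3 * SC n s c.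
Proof.
move=> c; have [k nE] : exists k, n = (6 * k)%N by exists (n %/ 6)%N; lia.
rewrite /US_expected_SC.
have -> : (n %/ 3 = 2 * k)%N by lia.
have -> : (n %/ 2 = 3 * k)%N by lia.
have -> : ((2 * n) %/ 3 = 4 * k)%N by lia.
set l := s (2 * k)%N; set m := s (3 * k)%N; set r := s (4 * k)%N.
have lm : l <= m by apply: hsorted; lia.
have mr : m <= r by apply: hsorted; lia.
have [g1 [g2 [g3 [g4 [g_ge0 h1 h2 h3 h4]]]]] := balanced_bounds R l m r c lm mr.
suff : 0 <= 5 * SC n s c - (SC n s l + SC n s m + SC n s r) by lra.
rewrite /SC mulr_sumr -!big_split /= -sumrB.
rewrite -/(\sum_(1 <= i < n.+1) excess R l m r c (s i)).
(* The agents defining [l], [m] and [r] are each the last of their piece. *)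
rewrite (@big_cat_nat _ _ _ (2 * k).+1) /=; [|lia..].
rewrite (@big_cat_nat _ _ _ (3 * k).+1 (2 * k).+1) /=; [|lia..].
rewrite (@big_cat_nat _ _ _ (4 * k).+1 (3 * k).+1) /=; [|lia..].
have b1 : (2 * k)%:R * g1 <= \sum_(1 <= i < (2 * k).+1) excess R l m r c (s i).
  by apply: sum_nat_ge_const => [|i hi]; [lia|apply: h1; apply: hsorted; lia].
have b2 : k%:R * g2 <=
    \sum_((2 * k).+1 <= i < (3 * k).+1) excess R l m r c (s i).
  apply: sum_nat_ge_const => [|i hi]; first lia.
  by apply: h2; apply/andP; split; apply: hsorted; lia.
have b3 : k%:R * g3 <=
    \sum_((3 * k).+1 <= i < (4 * k).+1) excess R l m r c (s i).
  apply: sum_nat_ge_const => [|i hi]; first lia.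
  by apply: h3; apply/andP; split; apply: hsorted; lia.
have b4 : (2 * k)%:R * g4 <=
    \sum_((4 * k).+1 <= i < n.+1) excess R l m r c (s i).
  by apply: sum_nat_ge_const => [|i hi]; [lia|apply: h4; apply: hsorted; lia].
(* The four lower bounds add up to [k] times the weighted sum. *)
have := mulr_ge0 (ler0n R k) g_ge0.
by move: b1 b4; rewrite natrM; lra.
Qed.
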